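(* Let $\Omega\subset\mathbb{R}^n$, $n\in\{1,2,3\}$, be a bounded domain that is regular in the sense of Gröger, let $f\in L^2(\Omega)$, let $\alpha>0$, and let $q_{\min},q_{\max},\psi\in\mathbb{R}$ with $0<q_{\min}<q_{\max}$ and $\psi>0$. Let $j\colon H_0^1(\Omega)\to\mathbb{R}$ be weakly lower semicontinuous, Fréchet differentiable and bounded from below. Set $$Q^{\mathrm{ad}}=\{q\in L^2(\Omega;\mathbb{R}^{n\times n}_{\mathrm{sym}}) : q_{\min}I\preccurlyeq q(x)\preccurlyeq q_{\max}I \text{ for a.e. } x\in\Omega\},\qquad K=\{u\in H_0^1(\Omega): u\le\psi\},$$ and let $S\colon Q^{\mathrm{ad}}\to H_0^1(\Omega)$ map $q$ to the unique $u\in K$ satisfying $(q\nabla u,\nabla(v-u))\ge(f,v-u)$ for all $v\in K$. Let $\bar q\in Q^{\mathrm{ad}}$ be a locally optimal control for the problem $$\min_{q\in Q^{\mathrm{ad}}}\; j(S(q))+\frac{\alpha}{2}\|q\|^2,$$ with associated state $\bar u=S(\bar q)$. Then $$j'(\bar u)\,S'(\bar q;q-\bar q)+\alpha(\bar q,q-\bar q)\ge 0\qquad\forall q\in Q^{\mathrm{ad}}.$$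
   Context: $\|\cdot\|$ and $(\cdot,\cdot)$ denote the $L^2(\Omega)$-norm and inner product for scalar-, vector- and matrix-valued functions (matrices carry the Frobenius inner product). $\mathbb{R}^{n\times n}_{\mathrm{sym}}$ is the space of symmetric matrices, $I$ the identity, and $A\preccurlyeq B$ means that $B-A$ is positive semidefinite. Gröger regularity (with homogeneous Dirichlet condition on all of $\partial\Omega$): every $x\in\partial\Omega$ has an open neighbourhood $V$ and a bi-Lipschitz map $\Phi$ from $V$ onto an open subset of $\mathbb{R}^n$ with $\Phi(x)=0$ and $\Phi(V\cap\Omega)=\{y\in\mathbb{R}^n:|y|<1,\ y_n<0\}$. $\bar q\in Q^{\mathrm{ad}}$ is locally optimal if there is $\varepsilon>0$ such that $j(S(\bar q))+\frac{\alpha}{2}\|\bar q\|^2\le j(S(q))+\frac{\alpha}{2}\|q\|^2$ for all $q\in Q^{\mathrm{ad}}$ with $\|q-\bar q\|\le\varepsilon$. For $q\in Q^{\mathrm{ad}}$ and $d\in L^2(\Omega;\mathbb{R}^{n\times n}_{\mathrm{sym}})$ with $q+d\in Q^{\mathrm{ad}}$, $S'(q;d)=\lim_{t\downarrow0}\frac{S(q+td)-S(q)}{t}$ denotes the directional derivative, a limit in $H_0^1(\Omega)$, which exists for all such $q,d$. $j'(\bar u)\in H^{-1}(\Omega)$ is the Fréchet derivative of $j$ at $\bar u$, applied by duality to elements of $H_0^1(\Omega)$. *)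

(* Defs.v *)
From HB Require Import structures.
From mathcomp Require Import all_boot all_order all_algebra.
From mathcomp Require Import all_classical all_reals all_analysis.
From mathcomp Require Import measurable_realfun ring_quotient.
From mathcomp Require Import ring lra.
Set Implicit Arguments.
Unset Strict Implicit.
Unset Printing Implicit Defensive.
Import Order.TTheory GRing.Theory Num.Def Num.Theory.
Import Quotient.
Import numFieldNormedType.Exports.
Local Open Scope classical_set_scope.
Local Open Scope ring_scope.
Local Open Scope quotient_scope.

(* 'rV[R]_n carries the sigma-algebra generated by the coordinates; it contains
   the open sets (rV_open_measurable), hence is the Borel sigma-algebra. *)
Section rV_measurable.
Context (R : realType) (n : nat).

Definition rV_coord (i : 'I_n) (x : 'rV[R]_n) : measurableTypeR R := x ord0 i.

Let rV0 : g_sigma_preimage rV_coord set0.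
Proof. exact: sigma_algebra0. Qed.

Let rVC A : g_sigma_preimage rV_coord A -> g_sigma_preimage rV_coord (~` A).
Proof. exact: sigma_algebraC. Qed.

Let rV_bigcup (F : (set 'rV[R]_n)^nat) :
  (forall i, g_sigma_preimage rV_coord (F i)) ->
  g_sigma_preimage rV_coord (\bigcup_i F i).
Proof. exact: sigma_algebra_bigcup. Qed.

Definition rV_display : measure_display.
Proof. exact: (measure_tuple_display default_measure_display). Qed.

HB.instance Definition _ := @isMeasurable.Build rV_display 'rV[R]_n
  (g_sigma_preimage rV_coord) rV0 rVC rV_bigcup.

Lemma measurable_coord (i : 'I_n) :
  measurable_fun setT (fun x : 'rV[R]_n => x ord0 i).
Proof.
move=> _ Y mY; rewrite setTI; apply: sub_sigma_algebra.
rewrite -bigcup_seq/=; exists i => /=; first by rewrite mem_index_enum.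
by exists Y => //; rewrite setTI.
Qed.

Lemma measurable_rVP d (T : measurableType d) (f : T -> 'rV[R]_n) :
  (forall i, measurable_fun setT (fun x => f x ord0 i)) -> measurable_fun setT f.
Proof.
move=> mf _ A; rewrite /measurable/= => mA.
have : preimage_set_system [set: T] f (g_sigma_preimage rV_coord)
    (setT `&` f @^-1` A) by exists A.
rewrite -g_sigma_preimageE; apply: smallest_sub.
  exact: sigma_algebra_measurable.
move=> _ [B + <-]; rewrite -bigcup_seq/= => -[i _ [C mC <-]].
rewrite !setTI; have := mf i measurableT C mC.
by rewrite setTI.
Qed.

End rV_measurable.

Section open_measurable_rV.
Context (R : realType) (n : nat).
Implicit Types U A : set 'rV[R]_n.


Lemma measurable_rV_ball (a : 'rV[R]_n) (r : R) : 0 < r ->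
  measurable (ball a r).
Proof.
move=> r0.
have -> : ball a r = \big[setI/setT]_(i < n)
    ((fun x : 'rV[R]_n => x ord0 i) @^-1` (ball (a ord0 i) r)).
  apply/seteqP; split => x /=.
    by move=> ax; rewrite -bigcap_seq => i _ /=; case: ax.
  rewrite -bigcap_seq => H; split => // i j; rewrite (ord1 i).
  by apply: H => /=; rewrite mem_index_enum.
apply: bigsetI_measurable => i _.
rewrite -[X in measurable X]setTI; apply: (measurable_coord i) => //.
exact: measurable_ball.
Qed.

Lemma rV_open_measurable U : open U -> measurable U.
Proof.
move=> oU.
pose B (p : 'rV[rat]_n * nat) : set 'rV[R]_n :=
  if `[< ball (map_mx ratr p.1 : 'rV[R]_n) (p.2.+1%:R^-1) `<=` U >]
  then ball (map_mx ratr p.1 : 'rV[R]_n) (p.2.+1%:R^-1) else set0.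
have -> : U = \bigcup_p B p.
  apply/seteqP; split => [x Ux|x [p _]]; last first.
    by rewrite /B; case: ifPn => // /asboolP; apply.
  have /nbhs_ballP[e /= e0 eU] := open_nbhs_nbhs (conj oU Ux).
  have e20 : 0 < e / 2 by rewrite divr_gt0.
  have [k _ /(_ _ (leqnn k)) /= ke] := near_infty_natSinv_lt (PosNum e20).
  have k0 : 0 < k.+1%:R^-1 :> R by rewrite invr_gt0.
  have /choice[q qP] : forall i : 'I_n, exists q : rat,
      ball (x ord0 i) k.+1%:R^-1 (ratr q : R).
    move=> i; have [q] := @rat_in_itvoo R (x ord0 i - k.+1%:R^-1)
      (x ord0 i + k.+1%:R^-1) ltac:(by rewrite ltrD2l (lt_trans _ k0)// oppr_lt0).
    by move=> xq; exists q; rewrite ball_itv.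
  pose c : 'rV[R]_n := map_mx ratr (\row_i q i).
  have cx : ball c k.+1%:R^-1 x.
    by split => // i j; rewrite (ord1 i) !mxE; apply/ball_sym/qP.
  exists (\row_i q i, k) => //; rewrite /B/=; case: ifPn => // /asboolP[] y cy.
  apply: eU; have := ball_triangle (ball_sym cx) cy.
  by apply: le_ball; rewrite [leRHS]splitr lerD// ltW.
apply: countable_bigcupT_measurable => // p; rewrite /B; case: ifPn => // _.
by apply: measurable_rV_ball; rewrite invr_gt0.
Qed.

Lemma continuous_rV_measurable (f : 'rV[R]_n -> R) :
  continuous f -> measurable_fun setT f.
Proof.
move=> /continuousP cf; apply: (measurability _ (RGenOpens.measurableE R)).
move=> _ [_ [a [b ->] <-]]; rewrite setTI.
by apply: rV_open_measurable; apply: cf; exact: interval_open.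
Qed.

End open_measurable_rV.

Section lebesgue_rV.
Context (R : realType).

Definition rV_cons n (p : measurableTypeR R * 'rV[R]_n) : 'rV[R]_n.+1 :=
  \row_i oapp (p.2 ord0) (p.1 : R) (unlift ord0 i).

Lemma measurable_rV_cons n : measurable_fun setT (@rV_cons n).
Proof.
apply: measurable_rVP => i.
case: (unliftP ord0 i) => [j|] ->.
  rewrite (_ : (fun _ => _) = (fun x : 'rV[R]_n => x ord0 j) \o snd).
    by apply: measurableT_comp => //; exact: measurable_coord.
  by apply/funext => -[x y]; rewrite !mxE/= liftK.
rewrite (_ : (fun _ => _) = fst) //.
by apply/funext => -[x y]; rewrite !mxE/= unlift_none.
Qed.

Definition rV_box n (k : nat) : set 'rV[R]_n :=
  [set x | forall i, `|x ord0 i| <= k%:R].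

Lemma measurable_rV_box n k : measurable (@rV_box n k).
Proof.
have -> : @rV_box n k = \big[setI/setT]_(i < n)
    ((fun x : 'rV[R]_n => x ord0 i) @^-1` `[- k%:R, k%:R]).
  apply/seteqP; split => x /=.
    move=> ax; rewrite -bigcap_seq => i _ /=.
    by rewrite in_itv/= -ler_norml; exact: ax.
  rewrite -bigcap_seq => H i.
  have := H i; rewrite /= in_itv/= -ler_norml; apply.
  by rewrite mem_index_enum.
apply: bigsetI_measurable => i _.
rewrite -[X in measurable X]setTI; apply: (measurable_coord i) => //.
Qed.

Lemma bigcup_rV_box n : \bigcup_k (@rV_box n k) = setT.
Proof.
apply/seteqP; split => // x _.
exists (truncn (\sum_i `|x ord0 i|)).+1 => //= i.
apply: le_trans (ltW (truncnS_gt _)).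
by rewrite (bigD1 i)//= lerDl sumr_ge0.
Qed.


Section lebesgue_rV_succ.
Context (n : nat) (mu : {sigma_finite_measure set 'rV[R]_n -> \bar R}).

Definition lebesgue_rV_succ : set 'rV[R]_n.+1 -> \bar R :=
  pushforward (lebesgue_measure \x mu)%E (@rV_cons n).

Let mcons A : measurable A -> measurable (@rV_cons n @^-1` A).
Proof.
by move=> mA; rewrite -[X in measurable X]setTI; exact: measurable_rV_cons.
Qed.

Let succ0 : lebesgue_rV_succ set0 = 0%E.
Proof. by rewrite /lebesgue_rV_succ /pushforward preimage_set0 measure0. Qed.

Let succ_ge0 A : (0 <= lebesgue_rV_succ A)%E.
Proof. exact: (measure_ge0 (lebesgue_measure \x mu)%E). Qed.

Let succ_sigma_additive : semi_sigma_additive lebesgue_rV_succ.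
Proof.
move=> F mF tF mUF; rewrite /lebesgue_rV_succ /pushforward preimage_bigcup.
apply: (@measure_semi_sigma_additive _ _ _ (lebesgue_measure \x mu)%E).
- by move=> k; exact: mcons.
- apply/trivIsetP => /= i j _ _ ij; rewrite -preimage_setI.
  by move/trivIsetP : tF => /(_ _ _ _ _ ij) ->//; rewrite preimage_set0.
- by rewrite -preimage_bigcup; exact: mcons.
Qed.

HB.instance Definition _ := isMeasure.Build _ _ _ lebesgue_rV_succ
  succ0 succ_ge0 succ_sigma_additive.

Let uncons (x : 'rV[R]_n.+1) : measurableTypeR R * 'rV[R]_n :=
  (x ord0 ord0, \row_i x ord0 (lift ord0 i)).

Let consK x : uncons (rV_cons x) = x.
Proof.
case: x => a y; rewrite /uncons mxE/= unlift_none; congr pair.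
by apply/rowP => i; rewrite !mxE liftK.
Qed.

Let measurable_uncons : measurable_fun setT uncons.
Proof.
apply: measurable_fun_pair => /=; first exact: measurable_coord.
by apply: measurable_rVP => i; under eq_fun do rewrite mxE;
  exact: measurable_coord.
Qed.

Let succ_sigma_finite : sigma_finite setT lebesgue_rV_succ.
Proof.
have /sigma_finiteP[F [FT ndF Foo]] := sigma_finiteT (@lebesgue_measure R).
have /sigma_finiteP[G [GT ndG Goo]] := sigma_finiteT mu.
exists (fun k => uncons @^-1` (F k `*` G k)).
  rewrite -preimage_bigcup (_ : \bigcup_k _ = setT) ?preimage_setT//.
  rewrite -setXTT FT GT predeqE => -[x y]; split => [[k _ []/= ? ?]|].
    by split; exists k.
  move=> [/= [k _ Fkx] [l _ Gly]]; exists (maxn k l) => //; split.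
  - by move: x Fkx; exact/subsetPset/ndF/leq_maxl.
  - by move: y Gly; exact/subsetPset/ndG/leq_maxr.
move=> k; have [mF Fk] := Foo k; have [mG Gk] := Goo k; split.
  by rewrite -[X in measurable X]setTI; apply: measurable_uncons => //;
    exact: measurableX.
rewrite /lebesgue_rV_succ /pushforward -comp_preimage.
rewrite (_ : uncons \o _ = id) ?preimage_id; last first.
  by apply/funext => x /=; rewrite consK.
by rewrite product_measure1E// lte_mul_pinfty// ge0_fin_numE.
Qed.

HB.instance Definition _ :=
  Measure_isSigmaFinite.Build _ _ _ lebesgue_rV_succ
    succ_sigma_finite.

Lemma lebesgue_rV_succ_box k : (mu (rV_box k) < +oo)%E ->
  (lebesgue_rV_succ (rV_box k) < +oo)%E.
Proof.
move=> muk; rewrite /lebesgue_rV_succ /pushforward.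
have -> : @rV_cons n @^-1` (rV_box k) = `[- k%:R, k%:R]%classic `*` rV_box k.
  apply/seteqP; split => [[a y] /= H|[a y] /= [ak yk] i].
    split; first by have := H ord0; rewrite mxE/= unlift_none/= in_itv/= ler_norml.
    by move=> i; have := H (lift ord0 i); rewrite mxE/= liftK.
  rewrite mxE/=; case: (unliftP ord0 i) => [j|] _ /=; first exact: yk.
  by rewrite ler_norml; move: ak; rewrite in_itv.
rewrite product_measure1E//; last exact: measurable_rV_box.
apply: lte_mul_pinfty => //; rewrite ge0_fin_numE//.
pose I : interval R := `[- k%:R, k%:R].
have H : (@lebesgue_measure R [set` I] < +oo)%E.
  by rewrite lebesgue_measure_itv/=; case: ifPn => _; rewrite -?EFinB ltry.
exact: H.
Qed.

End lebesgue_rV_succ.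

(* Lebesgue measure on R^n: the n-fold product of the one on R, transported along
   R * R^m -> R^(m+1). *)
Fixpoint lebesgue_rV (n : nat) :=
  match n return {sigma_finite_measure set 'rV[R]_n -> \bar R} with
  | 0 => @dirac _ _ (0 : 'rV[R]_0) R
  | m.+1 => lebesgue_rV_succ (lebesgue_rV m)
  end.

Lemma lebesgue_rV_bounded n (A : set 'rV[R]_n) :
  measurable A -> bounded_set A -> (lebesgue_rV n A < +oo)%E.
Proof.
move=> mA [M [_ AM]].
have box k : (lebesgue_rV n (rV_box k) < +oo)%E.
  elim: n {A mA AM} => [|n ih]/=; last exact: lebesgue_rV_succ_box.
  by rewrite diracE ltry.
pose k := (truncn (M + 1)).+1.
apply: le_lt_trans (box k); apply: le_measure; rewrite ?inE//.
  exact: measurable_rV_box.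
move=> x Ax i; have := AM (M + 1) ltac:(by rewrite ltrDl) x Ax => /= xM.
apply: le_trans (ltW (truncnS_gt _)); apply: le_trans xM.
rewrite [leRHS]/normr/= mx_normrE.
exact: (le_bigmax _ (fun ij => `|x ij.1 ij.2|) (ord0, i)).
Qed.

End lebesgue_rV.

Record bounded_domain (R : realType) (n : nat) := BoundedDomain {
  domain_set :> set 'rV[R]_n ;
  domain_open : open domain_set ;
  domain_connected : connected domain_set ;
  domain_nonempty : domain_set !=set0 ;
  domain_bounded : bounded_set domain_set }.

Section domain_measure.
Context (R : realType) (n : nat) (Omega : bounded_domain R n).

Lemma domain_measurable : measurable (Omega : set 'rV[R]_n).
Proof. by apply: rV_open_measurable; exact: domain_open. Qed.

(* All integrals over Omega are integrals over the whole space against this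
   measure, A |-> lebesgue (A `&` Omega); values outside Omega are irrelevant. *)
Definition domain_measure : set 'rV[R]_n -> \bar R :=
  mrestr (lebesgue_rV R n) domain_measurable.

HB.instance Definition _ := Measure.on domain_measure.

Let domain_measure_fin : fin_num_fun domain_measure.
Proof.
move=> A mA; rewrite ge0_fin_numE//.
apply: le_lt_trans (lebesgue_rV_bounded domain_measurable (domain_bounded Omega)).
apply: le_measure; rewrite ?inE//; first exact: measurableI domain_measurable.
exact: domain_measurable.
Qed.

HB.instance Definition _ := Measure_isFinite.Build _ _ _ domain_measure
  domain_measure_fin.

End domain_measure.

Section L2.
Context (R : realType) (n : nat) (Omega : bounded_domain R n).
Local Notation mu := (domain_measure Omega).

(* Elements of L^2(Omega) are given by representatives, functions on the whole
   space; everything below depends only on their classes modulo a.e. equality. *)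
Definition L2 (f : 'rV[R]_n -> R) : Prop := f \in Lfun mu 2%:E.

Definition L2mx m k (F : 'rV[R]_n -> 'M[R]_(m, k)) : Prop :=
  forall i j, L2 (fun x => F x i j).

Definition L2_ip (f g : 'rV[R]_n -> R) : R := \int[mu]_x (f x * g x).

Definition L2mx_ip m k (F G : 'rV[R]_n -> 'M[R]_(m, k)) : R :=
  \int[mu]_x \sum_i \sum_j F x i j * G x i j.

Definition L2mx_norm m k (F : 'rV[R]_n -> 'M[R]_(m, k)) : R :=
  Num.sqrt (L2mx_ip F F).

Lemma L2_measurable f : L2 f -> measurable_fun setT f.
Proof. by rewrite /L2 inE => /andP[]; rewrite inE. Qed.

Lemma L2_integrableM f g : L2 f -> L2 g ->
  mu.-integrable setT (EFin \o (fun x => f x * g x)).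
Proof. by move=> f2 g2; apply/Lfun1_integrable/Lfun2_mul_Lfun1. Qed.

Lemma L2_lin a f g : L2 f -> L2 g -> L2 (fun x => a * f x + g x).
Proof.
move=> f2 g2; have := @Lfun_submod_closed _ _ R mu 2%:E (lee1n 2).
by move=> -[_ /(_ a f g f2 g2)].
Qed.

Lemma L2mx_lin m k a (F G : 'rV[R]_n -> 'M[R]_(m, k)) :
  L2mx F -> L2mx G -> L2mx (a *: F + G).
Proof.
move=> F2 G2 i j; rewrite (_ : (fun _ => _) = (fun x => a * F x i j + G x i j)).
  exact: L2_lin.
by apply/funext => x; rewrite !mxE.
Qed.

Lemma L2_bounded (f : 'rV[R]_n -> R) (M : R) : measurable_fun setT f -> (forall x, `|f x| <= M) ->
  L2 f.
Proof.
move=> mf fM; rewrite /L2 inE; apply/andP; split; rewrite inE//=.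
rewrite /finite_norm unlock poweR_lty//.
rewrite (eq_integral (fun x => (f x ^+ 2)%:E)); last first.
  by move=> x _; rewrite /= powR_mulrn// real_normK// num_real.
apply: (@le_lt_trans _ _ (\int[mu]_x (M ^+ 2)%:E)%E).
  apply: ge0_le_integral => //.
  - by move=> x _; rewrite lee_fin sqr_ge0.
  - by apply/measurable_EFinP; exact: measurable_funX.
  - move=> x _; rewrite /= lee_fin -real_normK ?num_real// lerXn2r// nnegrE//.
    exact: le_trans (fM x).
rewrite integral_cst//= lte_mul_pinfty ?lee_fin ?sqr_ge0//.
by rewrite ltey_eq fin_num_measure.
Qed.

Lemma L2mx_integrable m k (F G : 'rV[R]_n -> 'M[R]_(m, k)) :
  L2mx F -> L2mx G ->
  mu.-integrable setT (EFin \o (fun x => \sum_i \sum_j F x i j * G x i j)).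
Proof.
move=> F2 G2; rewrite (_ : _ \o _ =
    (fun x => \sum_i \sum_j (F x i j * G x i j)%:E)%E).
  apply: integrable_sum => // i _; apply: integrable_sum => // j _.
  exact: L2_integrableM.
by apply/funext => x /=; rewrite -sumEFin; apply: eq_bigr => i _; rewrite sumEFin.
Qed.

End L2.

Section test_functions.
Context (R : realType) (n : nat) (Omega : bounded_domain R n).
Local Notation mu := (domain_measure Omega).
Implicit Types f g phi psi : 'rV[R]_n -> R.

Definition partial (i : 'I_n) f : 'rV[R]_n -> R :=
  fun x => 'D_(delta_mx ord0 i) f x.

Definition grad f : 'rV[R]_n -> 'cV[R]_n := fun x => \col_i partial i f x.

Definition smooth f : Prop := forall s : seq 'I_n,
  continuous (foldr partial f s) /\
  forall i x, derivable (foldr partial f s) x (delta_mx ord0 i).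

Definition test_function phi : Prop := smooth phi /\
  exists2 C, compact C & C `<=` Omega /\ forall x, ~ C x -> phi x = 0.

Lemma smooth_lin a f g : smooth f -> smooth g -> smooth (a *: f + g).
Proof.
move=> sf sg s.
have -> : foldr partial (a *: f + g) s =
    a *: foldr partial f s + foldr partial g s.
  elim: s => //= i s ->; apply/funext => x; rewrite /partial.
  rewrite deriveD; [|exact/derivableZ/(sf s).2|exact: (sg s).2].
  by rewrite deriveZ//; exact: (sf s).2.
split => [x|i x]; last first.
  by apply: derivableD; [exact/derivableZ/(sf s).2|exact: (sg s).2].
apply: continuousD; last exact: (sg s).1.
by apply: continuousZr; exact: (sf s).1.
Qed.

Lemma grad_lin a f g : smooth f -> smooth g ->
  grad (a *: f + g) = a *: grad f + grad g.
Proof.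
move=> sf sg; apply/funext => x; apply/colP => i; rewrite !mxE /partial.
rewrite deriveD; [|exact/derivableZ/(sf [::]).2|exact: (sg [::]).2].
by rewrite deriveZ//; exact: (sf [::]).2.
Qed.

Lemma test_function_lin a f g :
  test_function f -> test_function g -> test_function (a *: f + g).
Proof.
move=> [sf [C cC [CO f0]]] [sg [D cD [DO g0]]]; split; first exact: smooth_lin.
exists (C `|` D); first exact: compactU.
split => [x [/CO|/DO]//|x /not_orP[Cx Dx]].
by rewrite -[LHS]/(a * f x + g x) f0// g0// mulr0 addr0.
Qed.

Lemma test_function0 : test_function 0.
Proof.
split; last by exists set0; [exact: compact0|split].
have p0 s : foldr partial (0 : 'rV[R]_n -> R) s = cst 0.
  elim: s => //= i s ->; apply/funext => x; rewrite /partial.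
  exact: derive_cst.
by move=> s; rewrite p0; split => [x|i x]; [exact: cst_continuous|exact: derivable_cst].
Qed.

Lemma compact_support_L2 f C : continuous f -> compact C ->
  (forall x, ~ C x -> f x = 0) -> L2 Omega f.
Proof.
move=> cf cC f0.
have [M [_ fM]] : bounded_set (f @` C).
  apply: compact_bounded; apply: continuous_compact => //.
  exact: continuous_subspaceT.
apply: (@L2_bounded _ _ _ _ (`|M| + 1)); first exact: continuous_rV_measurable.
move=> x; have [Cx|/f0->] := pselect (C x); last by rewrite normr0 addr_ge0.
apply: (fM (`|M| + 1)); last by exists x.
by rewrite (le_lt_trans (ler_norm M))// ltrDl.
Qed.

Lemma test_function_L2 phi : test_function phi -> L2 Omega phi.
Proof. by move=> [s [C cC [_ f0]]]; exact: (compact_support_L2 (s [::]).1 cC f0). Qed.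

Lemma grad_test_function_L2 phi : test_function phi -> L2mx Omega (grad phi).
Proof.
move=> [s [C cC [_ f0]]] i j.
rewrite (_ : (fun _ => _) = partial i phi); last first.
  by apply/funext => x; rewrite mxE.
apply: (compact_support_L2 (s [:: i]).1 cC) => x Cx.
change ('D_(delta_mx ord0 i) phi x = 0).
rewrite (@near_eq_derive _ _ _ _ (cst 0)) ?derive_cst//.
have oC : open (~` C).
  apply: closed_openC; by apply: compact_closed cC; exact: norm_hausdorff.
have : nbhs x (~` C) by exact: open_nbhs_nbhs.
by apply: filterS => y; exact: f0.
Qed.

End test_functions.

Section H01.
Context (R : realType) (n : nat) (Omega : bounded_domain R n).
Local Notation mu := (domain_measure Omega).
Local Notation E := (('rV[R]_n -> R) * ('rV[R]_n -> 'cV[R]_n))%type.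
Implicit Types w v : E.

Definition weak_gradient (u : 'rV[R]_n -> R) (g : 'rV[R]_n -> 'cV[R]_n) : Prop :=
  forall phi, test_function Omega phi -> forall i,
    \int[mu]_x (u x * partial i phi x) = - \int[mu]_x (g x i ord0 * phi x).

Definition H1_sqdist w v (x : 'rV[R]_n) : R :=
  (w.1 x - v.1 x) ^+ 2 + \sum_i (w.2 x i ord0 - v.2 x i ord0) ^+ 2.

(* Pairs (u, g) with u in L^2, g = the weak gradient of u in L^2, and (u, g) in the
   closure of {(phi, grad phi) | phi test function} for the H^1-norm.  Since g is
   determined by u a.e., these pairs modulo null pairs are H_0^1(Omega).  The
   integral is extended-real valued, so that it cannot vanish for want of
   integrability. *)
Definition H01_pred : {pred E} := mem [set w : E |
  [/\ L2 Omega w.1, L2mx Omega w.2, weak_gradient w.1 w.2 &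
      forall eps : R, 0 < eps -> exists2 phi, test_function Omega phi &
        (\int[mu]_x (H1_sqdist w (phi, grad phi) x)%:E < eps%:E)%E]].

Lemma measurable_H1_sqdist w v : L2 Omega w.1 -> L2mx Omega w.2 ->
  L2 Omega v.1 -> L2mx Omega v.2 ->
  measurable_fun setT (EFin \o H1_sqdist w v).
Proof.
move=> /L2_measurable w1 w2 /L2_measurable v1 v2; apply/measurable_EFinP.
apply: measurable_funD.
  by apply: measurable_funX; exact: measurable_funB.
apply: measurable_sum => i; apply: measurable_funX.
by apply: measurable_funB; exact: L2_measurable.
Qed.

Lemma H1_sqdist_ge0 w v x : 0 <= H1_sqdist w v x.
Proof. by rewrite addr_ge0 ?sqr_ge0// sumr_ge0// => i _; exact: sqr_ge0. Qed.

Lemma H1_sqdist_lin a w w' v v' x : H1_sqdist (a *: w + v) (a *: w' + v') x <=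
  2 * a ^+ 2 * H1_sqdist w w' x + 2 * H1_sqdist v v' x.
Proof.
have sq (p q r s : R) : (a * p + q - (a * r + s)) ^+ 2 <=
    2 * a ^+ 2 * (p - r) ^+ 2 + 2 * (q - s) ^+ 2.
  rewrite -subr_ge0 (_ : _ - _ = (a * (p - r) - (q - s)) ^+ 2); last by ring.
  exact: sqr_ge0.
rewrite /H1_sqdist !mulrDr addrACA lerD//; first exact: sq.
rewrite !mulr_sumr -big_split/=; apply: ler_sum => i _.
rewrite !mxE; exact: sq.
Qed.

Lemma H01_submod_closed : submod_closed H01_pred.
Proof.
split=> [|a w v].
  rewrite inE; split.
  - apply: (@L2_bounded _ _ _ _ 0); first exact: measurable_cst.
    by move=> x; rewrite normr0.
  - move=> i j; apply: (@L2_bounded _ _ _ _ 0).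
      rewrite (_ : (fun _ => _) = cst 0); first exact: measurable_cst.
      by apply/funext => x; rewrite mxE.
    by move=> x; rewrite mxE normr0.
  - move=> phi _ i.
    under eq_Rintegral do rewrite mul0r.
    under [in RHS]eq_Rintegral do rewrite mxE mul0r.
    by rewrite Rintegral_cst// mul0r oppr0.
  - move=> e e0; exists 0; first exact: test_function0.
    rewrite (eq_integral (cst 0%E)) ?integral0 ?lte_fin// => x _.
    rewrite /H1_sqdist/= subrr expr0n add0r big1// => i _.
    by rewrite !mxE /partial derive_cst subrr expr0n.
rewrite !inE => -[w1 w2 wg wa] [v1 v2 vg va].
split.
- exact: L2_lin.
- exact: L2mx_lin.
- move=> phi tphi i.
  have phi1 := test_function_L2 tphi.
  have phi2 : L2 Omega (partial i phi).
    rewrite (_ : partial i phi = fun x => grad phi x i ord0).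
      exact: grad_test_function_L2.
    by apply/funext => x; rewrite mxE.
  rewrite (_ : (fun x => _ * partial i phi x) = (fun x =>
      a * (w.1 x * partial i phi x) + v.1 x * partial i phi x)); last first.
    by apply/funext => x; rewrite mulrA -mulrDl.
  rewrite (_ : (fun x => _ * phi x) = (fun x =>
      a * (w.2 x i ord0 * phi x) + v.2 x i ord0 * phi x)); last first.
    by apply/funext => x; rewrite !mxE mulrA -mulrDl.
  rewrite !RintegralD ?RintegralZl ?wg// ?vg//; try exact: L2_integrableM.
  + by rewrite opprD mulrN.
  + exact: (integrableZl measurableT a (L2_integrableM (w2 i ord0) phi1)).
  + exact: (integrableZl measurableT a (L2_integrableM w1 phi2)).
- move=> e e0.
  have [|phi tphi hphi] := wa (e / (4 * (a ^+ 2 + 1))).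
    by rewrite divr_gt0// mulr_gt0// ltr_wpDl// sqr_ge0.
  have [|psi tpsi hpsi] := va (e / 4); first by rewrite divr_gt0.
  exists (a *: phi + psi); first exact: test_function_lin.
  rewrite (_ : (_, _) = a *: ((phi, grad phi) : E) + (psi, grad psi)); last first.
    by rewrite grad_lin; [|exact: tphi.1|exact: tpsi.1].
  have p1 := test_function_L2 tphi; have p2 := grad_test_function_L2 tphi.
  have s1 := test_function_L2 tpsi; have s2 := grad_test_function_L2 tpsi.
  have mw := @measurable_H1_sqdist w (phi, grad phi) w1 w2 p1 p2.
  have mv := @measurable_H1_sqdist v (psi, grad psi) v1 v2 s1 s2.
  apply: (@le_lt_trans _ _ (\int[mu]_x
    ((2 * a ^+ 2)%:E * (H1_sqdist w (phi, grad phi) x)%:E +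
     2%:E * (H1_sqdist v (psi, grad psi) x)%:E))%E).
    apply: ge0_le_integral => //.
    + by move=> x _; rewrite lee_fin H1_sqdist_ge0.
    + by apply: measurable_H1_sqdist => //=;
        [exact: L2_lin|exact: L2mx_lin|exact: L2_lin|exact: L2mx_lin].
    + by apply: emeasurable_funD; apply: measurable_funeM;
        [exact: mw|exact: mv].
    + by move=> x _; rewrite -!EFinM -EFinD lee_fin; exact: H1_sqdist_lin.
  have a20 : 0 <= 2 * a ^+ 2 by rewrite mulr_ge0// sqr_ge0.
  have -> : (\int[mu]_x ((2 * a ^+ 2)%:E * (H1_sqdist w (phi, grad phi) x)%:E +
       2%:E * (H1_sqdist v (psi, grad psi) x)%:E) =
     (2 * a ^+ 2)%:E * \int[mu]_x (H1_sqdist w (phi, grad phi) x)%:E +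
     2%:E * \int[mu]_x (H1_sqdist v (psi, grad psi) x)%:E)%E.
    rewrite -!ge0_integralZl//;
      try by move=> x _; rewrite lee_fin H1_sqdist_ge0.
    apply: ge0_integralD => //; try by apply: measurable_funeM.
    + by move=> x _; rewrite -EFinM lee_fin mulr_ge0// H1_sqdist_ge0.
    + by move=> x _; rewrite -EFinM lee_fin mulr_ge0// H1_sqdist_ge0.
  rewrite (_ : e = 2 * a ^+ 2 * (e / (4 * (a ^+ 2 + 1))) +
    e / (a ^+ 2 + 1) / 2 + 2 * (e / 4)); last first.
    by field; rewrite lt0r_neq0// ltr_wpDl// sqr_ge0.
  rewrite [ltRHS]EFinD; apply: lteD; last by rewrite EFinM lte_pmul2l.
  apply: (@le_lt_trans _ _ ((2 * a ^+ 2)%:E * (e / (4 * (a ^+ 2 + 1)))%:E)%E).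
    by rewrite lee_wpmul2l ?lee_fin// ltW.
  rewrite -EFinM lte_fin ltrDl divr_gt0// divr_gt0//.
  by rewrite ltr_wpDl// sqr_ge0.
Qed.

End H01.


Section semi_inner_product.
Context (R : realType) (V : lmodType R) (B : V -> V -> R).
Hypothesis Bsym : forall x y, B x y = B y x.
Hypothesis Blin : forall a x y z, B (a *: x + y) z = a * B x z + B y z.
Hypothesis Bge0 : forall x, 0 <= B x x.

Let nB x := Num.sqrt (B x x).

Let Bquad a x y : B (a *: x + y) (a *: x + y) =
  a ^+ 2 * B x x + 2 * a * B x y + B y y.
Proof.
rewrite Blin (Bsym x) Blin (Bsym y (_ + _)) Blin (Bsym y x); ring.
Qed.

Let B_cauchy x y : B x y ^+ 2 <= B x x * B y y.
Proof.
have [xx0|xx0] := eqVneq (B x x) 0.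
  have [->|xy0] := eqVneq (B x y) 0; first by rewrite expr0n mulr_ge0.
  have := Bge0 ((- (B y y + 1) / (2 * B x y)) *: x + y).
  rewrite Bquad xx0 mulr0 add0r.
  rewrite (_ : 2 * _ * _ + _ = -1) ?ler0N1//; by field.
have xx : 0 < B x x by rewrite lt_neqAle eq_sym xx0 Bge0.
have := Bge0 ((- B x y / B x x) *: x + y); rewrite Bquad.
rewrite (_ : _ + _ = (B x x * B y y - B x y ^+ 2) / B x x); last by field.
by rewrite pmulr_lge0 ?invr_gt0// subr_ge0.
Qed.

Lemma semi_ipD x y : nB (x + y) <= nB x + nB y.
Proof.
rewrite -[leRHS]ger0_norm ?addr_ge0 ?sqrtr_ge0// -sqrtr_sqr ler_wsqrtr//.
rewrite -[x in x + y]scale1r Bquad expr1n mul1r mulr1 sqrrD !sqr_sqrtr//.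
rewrite lerD2r lerD2l -[leRHS]mulr_natl ler_pM2l// -sqrtrM//.
by rewrite (le_trans (ler_norm _))// -sqrtr_sqr ler_wsqrtr// B_cauchy.
Qed.

Lemma semi_ipZ a x : nB (a *: x) = `|a| * nB x.
Proof.
rewrite -[a *: x]addr0 /nB Bquad.
have -> : B x 0 = 0 by have := Blin (-1) 0 0 x; rewrite scaler0 addr0 (Bsym x); lra.
have -> : B 0 0 = 0 by have := Blin (-1) 0 0 0; rewrite scaler0 addr0; lra.
by rewrite mulr0 !addr0 sqrtrM ?sqr_ge0// sqrtr_sqr.
Qed.

End semi_inner_product.

Section H01_rep.
Context (R : realType) (n : nat) (Omega : bounded_domain R n).
Local Notation mu := (domain_measure Omega).
Local Notation E := (('rV[R]_n -> R) * ('rV[R]_n -> 'cV[R]_n))%type.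

HB.instance Definition _ := GRing.isSubmodClosed.Build R E (H01_pred Omega)
  (H01_submod_closed Omega).

Record H01_rep := H01Rep { H01_val : E ; _ : H01_val \in H01_pred Omega }.

HB.instance Definition _ := [isSub for H01_val].
HB.instance Definition _ := [Choice of H01_rep by <:].
HB.instance Definition _ := [SubChoice_isSubLmodule of H01_rep by <:].

Definition H01_rep_ip (w v : H01_rep) : R :=
  L2_ip Omega (val w).1 (val v).1 + L2mx_ip Omega (val w).2 (val v).2.

Definition H01_rep_norm (w : H01_rep) : R := Num.sqrt (H01_rep_ip w w).

Lemma H01_rep_L2 (w : H01_rep) : L2 Omega (val w).1 /\ L2mx Omega (val w).2.
Proof. by have := valP w; rewrite inE => -[]. Qed.

Lemma H01_rep_ipC w v : H01_rep_ip w v = H01_rep_ip v w.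
Proof.
rewrite /H01_rep_ip /L2_ip /L2mx_ip.
under eq_Rintegral do rewrite mulrC; congr (_ + _).
apply: eq_Rintegral => x _; apply: eq_bigr => i _; apply: eq_bigr => j _.
exact: mulrC.
Qed.

Lemma H01_rep_ip_lin a w v z :
  H01_rep_ip (a *: w + v) z = a * H01_rep_ip w z + H01_rep_ip v z.
Proof.
have [w1 w2] := H01_rep_L2 w; have [v1 v2] := H01_rep_L2 v.
have [z1 z2] := H01_rep_L2 z.
rewrite /H01_rep_ip mulrDr addrACA; congr (_ + _); rewrite /L2_ip /L2mx_ip.
  rewrite -RintegralZl ?L2_integrableM// -RintegralD//.
  - apply: eq_Rintegral => x _.
    have -> : (val (a *: w + v)).1 x = a * (val w).1 x + (val v).1 x.
      by rewrite linearP.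
    by rewrite mulrDl mulrA.
  - exact: (integrableZl measurableT a (L2_integrableM w1 z1)).
  - exact: L2_integrableM.
rewrite -RintegralZl ?L2mx_integrable// -RintegralD//.
- apply: eq_Rintegral => x _; rewrite mulr_sumr -big_split; apply: eq_bigr => i _.
  rewrite mulr_sumr -big_split; apply: eq_bigr => j _.
  have -> : (val (a *: w + v)).2 x i j = a * (val w).2 x i j + (val v).2 x i j.
    by rewrite linearP/= !mxE.
  by rewrite mulrDl mulrA.
- exact: (integrableZl measurableT a (L2mx_integrable w2 z2)).
- exact: L2mx_integrable.
Qed.

Lemma H01_rep_ip_ge0 w : 0 <= H01_rep_ip w w.
Proof.
rewrite addr_ge0// Rintegral_ge0// => x _; first by rewrite -expr2 sqr_ge0.
by do 2 (rewrite sumr_ge0// => ? _); rewrite -expr2 sqr_ge0.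
Qed.

Lemma H01_rep_normD w v :
  H01_rep_norm (w + v) <= H01_rep_norm w + H01_rep_norm v.
Proof.
exact: (semi_ipD H01_rep_ipC H01_rep_ip_lin H01_rep_ip_ge0).
Qed.

Lemma H01_rep_normZ a w : H01_rep_norm (a *: w) = `|a| * H01_rep_norm w.
Proof. exact: (semi_ipZ H01_rep_ipC H01_rep_ip_lin). Qed.

Definition H01_null : {pred H01_rep} := [pred w | H01_rep_norm w == 0].

Lemma H01_null_zmod_closed : zmod_closed H01_null.
Proof.
split=> [|w v].
  by rewrite inE -(scale0r (0 : H01_rep)) H01_rep_normZ normr0 mul0r.
rewrite !inE => /eqP w0 /eqP v0; rewrite eq_le sqrtr_ge0 andbT.
rewrite (le_trans (H01_rep_normD _ _))// w0 add0r.
by rewrite -scaleN1r H01_rep_normZ v0 mulr0.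
Qed.

HB.instance Definition _ := GRing.isZmodClosed.Build H01_rep H01_null
  H01_null_zmod_closed.

(* H_0^1(Omega), normed by sqrt (|u|^2 + |grad u|^2) (L^2-norms). *)
Definition H01 : Type := {quot H01_null}.

HB.instance Definition _ := GRing.Zmodule.on H01.

Lemma H01_eqP (w v : H01_rep) :
  reflect (\pi_{quot H01_null} w = \pi_{quot H01_null} v)
    (H01_rep_norm (w - v) == 0).
Proof. by apply: (iffP idP) => [h|/eqP]; [apply/eqP|]; rewrite -idealrBE inE. Qed.

Definition H01_scale (a : R) (u : H01) : H01 := \pi_{quot H01_null} (a *: repr u).

Lemma H01_scale_pi a (w : H01_rep) :
  H01_scale a (\pi_{quot H01_null} w) = \pi_{quot H01_null} (a *: w).
Proof.
apply/H01_eqP; rewrite -scalerBr H01_rep_normZ.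
have /H01_eqP/eqP -> : \pi_{quot H01_null} (repr (\pi_{quot H01_null} w)) =
  \pi_{quot H01_null} w by rewrite reprK.
by rewrite mulr0.
Qed.

Lemma H01_pi_ind (P : H01 -> Prop) :
  (forall w, P (\pi_{quot H01_null} w)) -> forall u, P u.
Proof. by move=> h u; rewrite -[u]reprK. Qed.

Let scaleA a b (u : H01) : H01_scale a (H01_scale b u) = H01_scale (a * b) u.
Proof. by elim/H01_pi_ind: u => w; rewrite !H01_scale_pi scalerA. Qed.

Let scale1 : left_id 1 H01_scale.
Proof. by elim/H01_pi_ind => w; rewrite H01_scale_pi scale1r. Qed.

Let scaleDr : right_distributive H01_scale +%R.
Proof.
move=> a; elim/H01_pi_ind => w; elim/H01_pi_ind => v.
by rewrite -raddfD !H01_scale_pi -raddfD scalerDr.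
Qed.

Let scaleDl u : {morph H01_scale^~ u : a b / a + b}.
Proof.
by move=> a b; elim/H01_pi_ind: u => w; rewrite !H01_scale_pi -raddfD scalerDl.
Qed.

HB.instance Definition _ := GRing.Zmodule_isLmodule.Build R H01
  scaleA scale1 scaleDr scaleDl.

Definition H01_norm (u : H01) : R := H01_rep_norm (repr u).

Lemma H01_norm_pi w : H01_norm (\pi_{quot H01_null} w) = H01_rep_norm w.
Proof.
rewrite /H01_norm; set v := repr _.
have /H01_eqP/eqP vw : \pi_{quot H01_null} v = \pi_{quot H01_null} w.
  exact: reprK.
have /H01_eqP/eqP wv : \pi_{quot H01_null} w = \pi_{quot H01_null} v.
  by rewrite reprK.
apply/eqP; rewrite eq_le; apply/andP; split.
  by rewrite -[v](subrK w) (le_trans (H01_rep_normD _ _))// vw add0r.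
by rewrite -[w in leLHS](subrK v) (le_trans (H01_rep_normD _ _))// wv add0r.
Qed.

Let normD u v : H01_norm (u + v) <= H01_norm u + H01_norm v.
Proof.
elim/H01_pi_ind: u => w; elim/H01_pi_ind: v => z.
by rewrite -raddfD !H01_norm_pi H01_rep_normD.
Qed.

Let normZ a u : H01_norm (a *: u) = `|a| * H01_norm u.
Proof.
elim/H01_pi_ind: u => w; rewrite -[_ *: _]/(H01_scale _ _) H01_scale_pi.
by rewrite !H01_norm_pi H01_rep_normZ.
Qed.

Let norm_eq0 u : H01_norm u = 0 -> u = 0.
Proof.
elim/H01_pi_ind: u => w; rewrite H01_norm_pi => w0.
rewrite -(raddf0 (\pi_{quot H01_null})).
by apply/H01_eqP; rewrite subr0 w0.
Qed.

HB.instance Definition _ := Lmodule_isNormed.Build R H01 normD normZ norm_eq0.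

End H01_rep.

Section geometry.
Context (R : realType) (n : nat).

Definition euclidean_norm (x : 'rV[R]_n) : R :=
  Num.sqrt (\sum_i x ord0 i ^+ 2).

Definition boundary (A : set 'rV[R]_n) : set 'rV[R]_n :=
  closure A `\` interior A.

Definition bilipschitz_on (V : set 'rV[R]_n) (Phi : 'rV[R]_n -> 'rV[R]_n) : Prop :=
  exists2 L : R, 0 < L & forall x y, V x -> V y ->
    L^-1 * euclidean_norm (x - y) <= euclidean_norm (Phi x - Phi y) /\
    euclidean_norm (Phi x - Phi y) <= L * euclidean_norm (x - y).

(* The index i with i.+1 = n is the last coordinate. *)
Definition lower_half_ball : set 'rV[R]_n :=
  [set y | euclidean_norm y < 1 /\
           forall i : 'I_n, i.+1 = n -> y ord0 i < 0].

Definition groger_regular (Omega : set 'rV[R]_n) : Prop :=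
  forall x, boundary Omega x ->
  exists (V : set 'rV[R]_n) (Phi : 'rV[R]_n -> 'rV[R]_n),
    [/\ open V /\ V x, open (Phi @` V), bilipschitz_on V Phi, Phi x = 0 &
        Phi @` (V `&` Omega) = lower_half_ball].

Definition psd (A : 'M[R]_n) : Prop :=
  forall v : 'cV[R]_n, 0 <= (v^T *m A *m v) ord0 ord0.

Definition loewner_le (A B : 'M[R]_n) : Prop := psd (B - A).

End geometry.

Section obstacle_problem.
Context (R : realType) (n : nat) (Omega : bounded_domain R n).
Local Notation mu := (domain_measure Omega).

Definition H01_fun (u : H01 Omega) : 'rV[R]_n -> R := (val (repr u)).1.

Definition H01_grad (u : H01 Omega) : 'rV[R]_n -> 'cV[R]_n := (val (repr u)).2.

Definition L2sym (q : 'rV[R]_n -> 'M[R]_n) : Prop :=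
  L2mx Omega q /\ {ae mu, forall x, (q x)^T = q x}.

Definition Qad (qmin qmax : R) (q : 'rV[R]_n -> 'M[R]_n) : Prop :=
  L2sym q /\
  {ae mu, forall x, loewner_le qmin%:M (q x) /\ loewner_le (q x) qmax%:M}.

Definition obstacle_set (psi : R) : set (H01 Omega) :=
  [set u | {ae mu, forall x, H01_fun u x <= psi}].

Definition obstacle_solutions (f : 'rV[R]_n -> R) (psi : R)
    (q : 'rV[R]_n -> 'M[R]_n) : set (H01 Omega) :=
  [set u | obstacle_set psi u /\
    forall v, obstacle_set psi v ->
      L2_ip Omega f (H01_fun (v - u)) <=
      L2mx_ip Omega (fun x => q x *m H01_grad u x) (H01_grad (v - u))].

(* The solution operator S; for q in Qad, obstacle_solutions f psi q is a
   singleton by the Lions-Stampacchia theorem, and S q is its element. *)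
Definition control_to_state (f : 'rV[R]_n -> R) (psi : R)
    (q : 'rV[R]_n -> 'M[R]_n) : H01 Omega :=
  xget 0 (obstacle_solutions f psi q).

(* S'(q; d) = w, the limit being taken in the norm of H_0^1. *)
Definition is_dir_derivative (S : ('rV[R]_n -> 'M[R]_n) -> H01 Omega)
    (q d : 'rV[R]_n -> 'M[R]_n) (w : H01 Omega) : Prop :=
  t^-1 *: (S (q + t *: d) - S q) @[t --> 0^'+] --> w.

Definition weakly_cvg (u_ : nat -> H01 Omega) (u : H01 Omega) : Prop :=
  forall l : {linear H01 Omega -> R}, continuous l ->
    l (u_ k) @[k --> \oo] --> l u.

Definition weakly_lsc (j : H01 Omega -> R) : Prop :=
  forall (u_ : nat -> H01 Omega) (u : H01 Omega), weakly_cvg u_ u ->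
    ((j u)%:E <= limn_einf (fun k => (j (u_ k))%:E))%E.

Definition reduced_cost (j : H01 Omega -> R)
    (S : ('rV[R]_n -> 'M[R]_n) -> H01 Omega) (alpha : R)
    (q : 'rV[R]_n -> 'M[R]_n) : R :=
  j (S q) + alpha / 2 * L2mx_norm Omega q ^+ 2.

Definition locally_optimal (Q : set ('rV[R]_n -> 'M[R]_n))
    (J : ('rV[R]_n -> 'M[R]_n) -> R) (qbar : 'rV[R]_n -> 'M[R]_n) : Prop :=
  Q qbar /\ exists2 eps : R, 0 < eps &
    forall q, Q q -> L2mx_norm Omega (q - qbar) <= eps -> J qbar <= J q.

End obstacle_problem.

(* Main.v *)
Require Import Defs.
From mathcomp Require Import all_boot all_order all_algebra.
From mathcomp Require Import all_classical all_reals all_analysis.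
From mathcomp Require Import ring.
Set Implicit Arguments.
Unset Strict Implicit.
Unset Printing Implicit Defensive.
Import Order.TTheory GRing.Theory Num.Theory.
Import numFieldNormedType.Exports.
Local Open Scope classical_set_scope.
Local Open Scope ring_scope.

(** The first-order condition is the usual one-sided derivative test along a
    segment.  Put [d := q - qbar].  The admissible set is convex ([Qad_convex])
    and [t *: d] has small norm for small [t > 0] ([L2mx_normZ]), so local
    optimality makes the right difference quotients of the reduced cost at
    [qbar] along [d] nonnegative, and so is their limit.

    The limit is computed term by term.  The regularization term is a
    quadratic polynomial in [t] ([L2mx_norm_sqrDZ]), whose slope at [0] is
    [alpha * (qbar, d)].  For the term [j (S (qbar + t *: d))] the state is
    only directionally differentiable; this is enough because [j] is
    Fréchet differentiable, so that the chain rule holds along any curve that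
    has a right tangent ([cvg_right_quotient_comp]). *)

(** Writing [g t = x + t *: k t] with [k t --> v], the expansion of [f] at [x]
    gives the quotient ['d f x (k t)] plus [t^-1] times a remainder that is
    little-o of [t *: k t].  As [k] stays bounded near [0], the remainder term
    vanishes.  Fréchet differentiability cannot be weakened to Gateaux
    differentiability here, since the direction [k t] varies with [t]. *)
Lemma cvg_right_quotient_comp (R : realType) (V W : normedModType R)
    (f : V -> W) (g : R -> V) (x v : V) :
  differentiable f x -> t^-1 *: (g t - x) @[t --> 0^'+] --> v ->
  t^-1 *: (f (g t) - f x) @[t --> 0^'+] --> 'd f x v.
Proof.
move=> dfx gv; pose k t := t^-1 *: (g t - x).
have fxE := diff_locallyxC dfx; set o := (X in forall h, _ = _ + X h) in fxE.
have o_small : forall e, 0 < e -> \forall h \near 0, `|o h| <= e * `|h|.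
  by move=> e e0; exact: littleoP.
have tk0 : t *: k t @[t --> 0^'+] --> (0 : V).
  rewrite -(scale0r v); apply: cvgZ => //.
  exact: cvg_at_right_filter.
have rest0 : t^-1 *: o (t *: k t) @[t --> 0^'+] --> (0 : W).
  apply/cvgr0Pnorm_le => e e0.
  (* [`|v| + 1] bounds [k] near [0], being larger than the norm of its limit. *)
  have c0 : 0 < `|v| + 1 by rewrite ltr_wpDl.
  have kbnd : \forall t \near 0^'+, `|k t| <= `|v| + 1.
    by apply: cvgr_norm_le; [exact: gv|rewrite ltrDl].
  have otk : \forall t \near 0^'+,
      `|o (t *: k t)| <= e / (`|v| + 1) * `|t *: k t|.
    by apply: (tk0 _ (o_small _ _)); rewrite divr_gt0.
  near=> t.
  have t0 : 0 < t by near: t; exact: nbhs_right_gt.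
  have ot : `|o (t *: k t)| <= e / (`|v| + 1) * `|t *: k t| by near: t.
  rewrite normrZ normfV (gtr0_norm t0) ler_pdivrMl// (le_trans ot)//.
  rewrite normrZ (gtr0_norm t0) mulrCA ler_pM2l//.
  by rewrite mulrAC ler_pdivrMr// ler_pM2l//; near: t.
have main : 'd f x (k t) + t^-1 *: o (t *: k t) @[t --> 0^'+] --> 'd f x v.
  rewrite -[X in _ --> X]addr0; apply: cvgD => //.
  apply: (@cvg_comp _ _ _ k ('d f x) _ _ _ gv).
  exact: (diff_continuous dfx).
apply: cvg_trans main; apply: near_eq_cvg; near=> t.
have t0 : t != 0 by rewrite gt_eqF//; near: t; exact: nbhs_right_gt.
have gE : g t = x + t *: k t by rewrite /k scalerA divff// scale1r addrC subrK.
have lin h : 'd f x (t *: h) = t *: 'd f x h by rewrite linearZ.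
have -> : f (g t) - f x = t *: 'd f x (k t) + o (t *: k t).
  by rewrite gE fxE addrAC [f x + _]addrC addrK lin.
by rewrite scalerDr [t^-1 *: (_ *: _)]scalerA mulVf// scale1r.
Unshelve. all: by end_near. Qed.

Lemma psd_conic (R : realType) (n : nat) (a b : R) (A B : 'M[R]_n) :
  0 <= a -> 0 <= b -> psd A -> psd B -> psd (a *: A + b *: B).
Proof.
move=> a0 b0 pA pB v.
rewrite mulmxDr mulmxDl -!scalemxAr -!scalemxAl !mxE.
by have := pA v; have := pB v; rewrite !mxE => ? ?; rewrite addr_ge0 ?mulr_ge0.
Qed.

Lemma L2mxB (R : realType) (n m k : nat) (Omega : bounded_domain R n)
    (F G : 'rV[R]_n -> 'M[R]_(m, k)) :
  L2mx Omega F -> L2mx Omega G -> L2mx Omega (F - G).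
Proof. by move=> F2 G2; rewrite addrC -scaleN1r; exact: L2mx_lin. Qed.

(** Each value on the segment is the convex combination
    [(1 - t) *: p x + t *: q x], and the two Loewner bounds say that certain
    affine images of it lie in the convex cone of positive semidefinite
    matrices. *)
Lemma Qad_convex (R : realType) (n : nat) (Omega : bounded_domain R n)
    (qmin qmax t : R) (p q : 'rV[R]_n -> 'M[R]_n) :
  0 <= t <= 1 -> Qad Omega qmin qmax p -> Qad Omega qmin qmax q ->
  Qad Omega qmin qmax (p + t *: (q - p)).
Proof.
move=> /andP[t0 t1] [[p2 psym] pb] [[q2 qsym] qb].
have pqE x : (p + t *: (q - p)) x = (1 - t) *: p x + t *: q x.
  rewrite -[LHS]/(p x + t *: (q x - p x)) scalerBr scalerBl scale1r.
  by rewrite addrCA addrC.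
have s0 : 0 <= 1 - t by rewrite subr_ge0.
split; first split.
- by rewrite addrC; apply: L2mx_lin => //; exact: L2mxB.
- move: psym qsym; apply: filterS2 => x px qx.
  by rewrite pqE linearD !linearZ/= px qx.
- move: pb qb; apply: filterS2 => x [pl pu] [ql qu]; rewrite pqE.
  split; rewrite /loewner_le.
    rewrite (_ : _ - _ = (1 - t) *: (p x - qmin%:M) + t *: (q x - qmin%:M)).
      exact: psd_conic.
    by apply/matrixP => i k; rewrite !mxE; ring.
  rewrite (_ : _ - _ = (1 - t) *: (qmax%:M - p x) + t *: (qmax%:M - q x)).
    exact: psd_conic.
  by apply/matrixP => i k; rewrite !mxE; ring.
Qed.

Lemma L2mx_ip_ge0 (R : realType) (n m k : nat) (Omega : bounded_domain R n)
    (F : 'rV[R]_n -> 'M[R]_(m, k)) : 0 <= L2mx_ip Omega F F.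
Proof.
apply: Rintegral_ge0 => x _.
by do 2 (rewrite sumr_ge0// => ? _); rewrite -expr2 sqr_ge0.
Qed.

Lemma L2mx_ipC (R : realType) (n m k : nat) (Omega : bounded_domain R n)
    (F G : 'rV[R]_n -> 'M[R]_(m, k)) : L2mx_ip Omega F G = L2mx_ip Omega G F.
Proof.
apply: eq_Rintegral => x _; apply: eq_bigr => i _; apply: eq_bigr => l _.
exact: mulrC.
Qed.

Lemma L2mx_ip_lin (R : realType) (n m k : nat) (Omega : bounded_domain R n)
    (a : R) (F G H : 'rV[R]_n -> 'M[R]_(m, k)) :
  L2mx Omega F -> L2mx Omega G -> L2mx Omega H ->
  L2mx_ip Omega (a *: F + G) H = a * L2mx_ip Omega F H + L2mx_ip Omega G H.
Proof.
move=> F2 G2 H2; rewrite /L2mx_ip -RintegralZl ?L2mx_integrable// -RintegralD//.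
- apply: eq_Rintegral => x _; rewrite mulr_sumr -big_split; apply: eq_bigr => i _.
  rewrite mulr_sumr -big_split; apply: eq_bigr => l _.
  by rewrite -[(a *: F + G) x]/(a *: F x + G x) !mxE mulrDl mulrA.
- exact: (integrableZl measurableT a (L2mx_integrable F2 H2)).
- exact: L2mx_integrable.
Qed.

Lemma L2mx_norm_sqrDZ (R : realType) (n m k : nat) (Omega : bounded_domain R n)
    (t : R) (F G : 'rV[R]_n -> 'M[R]_(m, k)) :
  L2mx Omega F -> L2mx Omega G ->
  L2mx_norm Omega (F + t *: G) ^+ 2 = L2mx_norm Omega F ^+ 2 +
    2 * t * L2mx_ip Omega F G + t ^+ 2 * L2mx_norm Omega G ^+ 2.
Proof.
move=> F2 G2; rewrite !sqr_sqrtr ?L2mx_ip_ge0// addrC.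
have S2 : L2mx Omega (t *: G + F) by exact: L2mx_lin.
rewrite !L2mx_ip_lin// !(L2mx_ipC _ _ (t *: G + F)) !L2mx_ip_lin//.
rewrite (L2mx_ipC _ G F); ring.
Qed.

Lemma L2mx_normZ (R : realType) (n m k : nat) (Omega : bounded_domain R n)
    (t : R) (F : 'rV[R]_n -> 'M[R]_(m, k)) :
  L2mx Omega F -> L2mx_norm Omega (t *: F) = `|t| * L2mx_norm Omega F.
Proof.
(* This decomposition brings [t *: F] into the form [a *: F + G] of the
   linearity lemmas without a zero summand. *)
move=> F2; have tF : t *: F = (t - 1) *: F + F by rewrite scalerBl scale1r subrK.
have tF2 : L2mx Omega (t *: F) by rewrite tF; exact: L2mx_lin.
have ipZ G : L2mx Omega G -> L2mx_ip Omega (t *: F) G = t * L2mx_ip Omega F G.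
  by move=> G2; rewrite tF L2mx_ip_lin//; ring.
rewrite /L2mx_norm -sqrtr_sqr -sqrtrM ?sqr_ge0//; congr Num.sqrt.
by rewrite ipZ// L2mx_ipC ipZ// mulrA expr2.
Qed.

Theorem lemma3p3 (R : realType) (n : nat) (hn : (1 <= n <= 3)%N)
    (Omega : bounded_domain R n) (hOmega : groger_regular Omega)
    (f : 'rV[R]_n -> R) (hf : L2 Omega f)
    (alpha : R) (halpha : 0 < alpha)
    (qmin qmax psi : R) (hqmin : 0 < qmin) (hqmax : qmin < qmax) (hpsi : 0 < psi)
    (j : H01 Omega -> R) (hj_wlsc : weakly_lsc j)
    (hj_diff : forall u : H01 Omega, differentiable j u)
    (hj_bound : exists m : R, forall u : H01 Omega, m <= j u)
    (qbar : 'rV[R]_n -> 'M[R]_n)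
    (hqbar : locally_optimal Omega (Qad Omega qmin qmax)
       (reduced_cost j (control_to_state Omega f psi) alpha) qbar) :
  let S := control_to_state Omega f psi in
  let ubar := S qbar in
  forall q : 'rV[R]_n -> 'M[R]_n, Qad Omega qmin qmax q ->
  forall w : H01 Omega, is_dir_derivative S qbar (q - qbar) w ->
    0 <= 'd j ubar w + alpha * L2mx_ip Omega qbar (q - qbar).
Proof.
move=> S ubar q qQ w Sw.
have [pQ [eps eps0 opt]] := hqbar.
set J := reduced_cost _ _ _ in opt.
pose d := q - qbar.
have p2 : L2mx Omega qbar := pQ.1.1.
have d2 : L2mx Omega d by exact: L2mxB qQ.1.1 p2.
have jS : t^-1 *: (j (S (qbar + t *: d)) - j ubar) @[t --> 0^'+] --> 'd j ubar w.
  exact: cvg_right_quotient_comp.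
have idt : t @[t --> 0^'+] --> (0 : R) by exact: cvg_at_right_filter.
have J'E : t^-1 * (J (qbar + t *: d) - J qbar) @[t --> 0^'+] -->
    'd j ubar w + alpha * L2mx_ip Omega qbar d.
  have lim : t^-1 *: (j (S (qbar + t *: d)) - j ubar) +
      (alpha * L2mx_ip Omega qbar d + t * (alpha / 2 * L2mx_norm Omega d ^+ 2))
      @[t --> 0^'+] --> 'd j ubar w +
      (alpha * L2mx_ip Omega qbar d + 0 * (alpha / 2 * L2mx_norm Omega d ^+ 2)).
    by apply: cvgD => //; apply: cvgD; [exact: cvg_cst|exact: cvgMl].
  rewrite mul0r addr0 in lim; apply: cvg_trans lim; apply: near_eq_cvg.
  near=> t.
  have t0 : t != 0 by rewrite gt_eqF//; near: t; exact: nbhs_right_gt.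
  have JE p : J p = j (S p) + alpha / 2 * L2mx_norm Omega p ^+ 2 by [].
  rewrite !JE (L2mx_norm_sqrDZ t p2 d2) -[S qbar]/ubar -[_ *: _]/(_ * _).
  move: (j (S _)) (j ubar) (L2mx_norm _ _) (L2mx_norm _ _) (L2mx_ip _ _ _).
  by move=> *; field.
(* Adding 1 keeps the step bound [eps / (L2mx_norm Omega d + 1)] meaningful
   when [d] vanishes almost everywhere. *)
have c0 : 0 < L2mx_norm Omega d + 1 by rewrite ltr_wpDl// sqrtr_ge0.
apply: (cvgr_to_ge J'E); near=> t.
have t0 : 0 < t by near: t; exact: nbhs_right_gt.
have t1 : t <= 1 by near: t; exact: nbhs_right_le.
rewrite mulr_ge0 ?invr_ge0 ?(ltW t0)// subr_ge0; apply: opt.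
  by apply: Qad_convex => //; rewrite (ltW t0).
have te : t <= eps / (L2mx_norm Omega d + 1).
  by near: t; apply: nbhs_right_le; rewrite divr_gt0.
rewrite addrAC subrr add0r L2mx_normZ// (gtr0_norm t0).
rewrite ler_pdivlMr// in te; apply: le_trans te.
by rewrite ler_pM2l// lerDl.
Unshelve. all: by end_near. Qed.
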